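(* Let $m>1$ be an integer, let $G=\mathrm{Art}_m=\langle a,b\mid (a,b)_m=(b,a)_m\rangle$, and let $z$ be the element of $G$ represented by $(a,b)_m=(b,a)_m$. Then: (1) the center of $G$ is an infinite cyclic subgroup generated by $z$ when $m$ is even and by $z^2$ when $m$ is odd; (2) $G$ is virtually a direct product of a free group and an infinite cyclic group; (3) every nontrivial reduced word equivalent to the identity in $G$ contains a subword equal to $(a,b)_m$ or $(b,a)_m$ or their inverses; (4) every word equivalent to the identity in $G$ can be reduced to the identity by iteratively replacing $(a,b)_m$ with $(b,a)_m$, replacing $(b,a)_m$ with $(a,b)_m$, and performing free reductions.
   Context: For letters $a,b$ and a positive integer $m$, $(a,b)_m$ denotes the word of length $m$ that starts with $a$ and alternates between $a$ and $b$ (e.g. $(a,b)_3=aba$, $(a,b)_4=abab$); similarly $(b,a)_m$ starts with $b$. The group $\mathrm{Art}_m$ defined by the presentation $\langle a,b\mid (a,b)_m=(b,a)_m\rangle$ with $m>1$ is called a one-relator Artin group. Words are over the alphabet $\{a,b,a^{-1},b^{-1}\}$; a word is equivalent to the identity in $G$ if it represents the identity element of $G$. The inverse of a word $x_1x_2\cdots x_k$ is the word $x_k^{-1}\cdots x_2^{-1}x_1^{-1}$. A subword is a block of consecutive letters. A word is reduced if it contains no subword $xx^{-1}$ or $x^{-1}x$ with $x\in\{a,b\}$; a free reduction deletes such a subword; a nontrivial word is a nonempty one, and reducing a word to the identity means reducing it to the empty word. A group is virtually a direct product of a free group and an infinite cyclic group if it has a finite-index subgroup isomorphic to $F\times\mathbb{Z}$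 for some free group $F$.
   Formalization: Part (1) is stated only for m > 2, since for m = 2 the group is Z^2 and its center is not cyclic. In part (4) the inverses of (a,b)_m and (b,a)_m may also be replaced by each other, since otherwise the trivial reduced word a b^-1 a^-1 b (m = 2) cannot be reduced. *)

(* Defs.v *)
From Stdlib Require Import Relations.Relation_Operators.
From HB Require Import structures.
From mathcomp Require Import all_boot all_order all_algebra.
From mathcomp Require Import generic_quotient boolp.

Set Implicit Arguments.
Unset Strict Implicit.
Unset Printing Implicit Defensive.

Local Open Scope group_scope.
Local Open Scope quotient_scope.

(* The letter (x, false) stands for x and (x, true) for x^-1. *)
Definition word (X : Type) : Type := seq (X * bool).

Definition winv (X : Type) (w : word X) : word X :=
  rev [seq (l.1, ~~ l.2) | l <- w].

(* One replacement l => r with R l r inside a word, or one free reduction. *)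
Variant wstep (X : Type) (R : word X -> word X -> Prop) :
    word X -> word X -> Prop :=
  | WReplace u v l r of R l r : wstep R (u ++ l ++ v) (u ++ r ++ v)
  | WCancel u v x e : wstep R (u ++ [:: (x, e); (x, ~~ e)] ++ v) (u ++ v).

Definition weq (X : Type) (R : word X -> word X -> Prop) :
    word X -> word X -> Prop :=
  clos_refl_sym_trans (word X) (wstep R).

Section PresentedGroup.
Variables (X : choiceType) (R : word X -> word X -> Prop).

Definition weqb (u v : word X) : bool := `[< weq R u v >].

Lemma weqb_refl : reflexive weqb.
Proof. by move=> u; apply/asboolP; apply: rst_refl. Qed.

Lemma weqb_sym : symmetric weqb.
Proof. by move=> u v; apply/asboolP/asboolP; apply: rst_sym. Qed.

Lemma weqb_trans : transitive weqb.
Proof.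
by move=> v u w /asboolP uv /asboolP vw; apply/asboolP; apply: rst_trans uv vw.
Qed.

Canonical weqb_equiv := EquivRel weqb weqb_refl weqb_sym weqb_trans.

(* The group < X | l = r for all l, r such that R l r >. *)
Definition presented : Type := {eq_quot weqb_equiv}.

HB.instance Definition _ := Choice.on presented.

Definition wclass (w : word X) : presented := \pi_({eq_quot weqb_equiv}) w.

Lemma wclassP u v : wclass u = wclass v <-> weq R u v.
Proof.
by split=> [/eqmodP/asboolP //|uv]; apply/eqmodP; apply/asboolP.
Qed.

Definition wrepr (g : presented) : word X := repr (g : {eq_quot weqb_equiv}).

Lemma wreprK : cancel wrepr wclass.
Proof. by move=> g; rewrite /wclass /wrepr reprK. Qed.

Lemma weq_wrepr w : weq R (wrepr (wclass w)) w.
Proof. by apply/wclassP; rewrite wreprK. Qed.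

Lemma weq_ctx u v s t : weq R u v -> weq R (s ++ u ++ t) (s ++ v ++ t).
Proof.
elim=> {u v} [u v [p q l r lr|p q x e]|u|u v _|u v w _ uv _ vw].
- by rewrite -!catA ![s ++ p ++ _]catA; apply/rst_step/WReplace.
- by rewrite -!catA ![s ++ p ++ _]catA; apply/rst_step/WCancel.
- exact: rst_refl.
- exact: rst_sym.
- exact: rst_trans uv vw.
Qed.

Lemma weq_cat u u' v v' :
  weq R u u' -> weq R v v' -> weq R (u ++ v) (u' ++ v').
Proof.
move=> uu' vv'; apply: (@rst_trans _ _ _ (u' ++ v)).
  exact: (weq_ctx [::] v uu').
by have := weq_ctx u' [::] vv'; rewrite !cats0.
Qed.

Lemma winv_cons (l : X * bool) w : winv (l :: w) = rcons (winv w) (l.1, ~~ l.2).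
Proof. by rewrite /winv /= rev_cons. Qed.

Lemma winvK : involutive (@winv X).
Proof.
move=> w; rewrite /winv map_rev revK -map_comp map_id_in // => -[x e] _ /=.
by rewrite negbK.
Qed.

Lemma weq_mulV w : weq R (w ++ winv w) [::].
Proof.
elim: w => [|[x e] w IHw]; first exact: rst_refl.
rewrite winv_cons -cats1 /= -cat1s (catA w).
apply: rst_trans (weq_ctx [:: (x, e)] [:: (x, ~~ e)] IHw) _.
exact/rst_step/(WCancel R [::] [::]).
Qed.

Lemma weq_Vmul w : weq R (winv w ++ w) [::].
Proof. by have := weq_mulV (winv w); rewrite winvK. Qed.

Definition pmul (g h : presented) : presented := wclass (wrepr g ++ wrepr h).
Definition pinv (g : presented) : presented := wclass (winv (wrepr g)).

Lemma pmulA : associative pmul.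
Proof.
move=> x y z; apply/wclassP.
apply: (@rst_trans _ _ _ (wrepr x ++ wrepr y ++ wrepr z)).
  exact: weq_cat (rst_refl _ _ _) (weq_wrepr _).
by rewrite catA; apply: weq_cat (rst_refl _ _ _); apply/rst_sym/weq_wrepr.
Qed.

Lemma pmul1 : left_id (wclass [::]) pmul.
Proof.
move=> x; rewrite -[RHS]wreprK; apply/wclassP.
exact: (weq_cat (weq_wrepr [::]) (rst_refl _ _ _)).
Qed.

Lemma pmulr1 : right_id (wclass [::]) pmul.
Proof.
move=> x; rewrite -[RHS]wreprK -[wrepr x in RHS]cats0; apply/wclassP.
exact: (weq_cat (rst_refl _ _ _) (weq_wrepr [::])).
Qed.

Lemma pmulV : left_inverse (wclass [::]) pinv pmul.
Proof.
move=> x; apply/wclassP; apply: rst_trans (weq_Vmul (wrepr x)).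
exact: weq_cat (weq_wrepr _) (rst_refl _ _ _).
Qed.

Lemma pmulrV : right_inverse (wclass [::]) pinv pmul.
Proof.
move=> x; apply/wclassP; apply: rst_trans (weq_mulV (wrepr x)).
exact: weq_cat (rst_refl _ _ _) (weq_wrepr _).
Qed.

HB.instance Definition _ :=
  isGroup.Build presented pmulA pmul1 pmulr1 pmulV pmulrV.

Lemma wclass_nil : wclass [::] = 1.
Proof. by []. Qed.

Lemma wclass_cat u v : wclass (u ++ v) = wclass u * wclass v.
Proof. by apply/wclassP/weq_cat; apply/rst_sym/weq_wrepr. Qed.

End PresentedGroup.

Definition free_group (X : choiceType) : groupType :=
  presented (fun _ _ : word X => False).

(* The additive group of the integers, written multiplicatively. *)
Definition Zgroup : Type := int.

HB.instance Definition _ := Choice.on Zgroup.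
HB.instance Definition _ := isGroup.Build Zgroup
  (@GRing.addrA int) (@GRing.add0r int) (@GRing.addr0 int)
  (@GRing.addNr int) (@GRing.addrN int).

Section GroupNotions.
Variable G : groupType.

Definition expgz (x : G) (n : int) : G :=
  match n with Posz k => x ^+ k | Negz k => x ^- k.+1 end.

Definition center (g : G) : Prop := forall h : G, commute g h.

Definition infinite_cyclic_generated_by (S : G -> Prop) (c : G) : Prop :=
  (forall g, S g <-> exists n : int, g = expgz c n) /\ injective (expgz c).

Definition finite_index (S : {pred G}) : Prop :=
  exists ts : seq G, forall g : G, exists2 t, t \in ts & t^-1 * g \in S.

Definition isomorphic_subgroup (K : groupType) (S : {pred G}) : Prop :=
  exists f : {multiplicative K -> G},
    injective f /\ (forall g : G, g \in S <-> exists k : K, f k = g).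

Definition virtually_free_times_Z : Prop :=
  exists S : {pred G}, [/\ group_closed S, finite_index S
    & exists X : choiceType,
        isomorphic_subgroup (free_group X * Zgroup)%type S].

End GroupNotions.

Variant gen : Type := ga | gb.

Definition bool_of_gen (x : gen) : bool := if x is ga then true else false.
Definition gen_of_bool (e : bool) : gen := if e then ga else gb.
Lemma bool_of_genK : cancel bool_of_gen gen_of_bool.
Proof. by case. Qed.
HB.instance Definition _ := Countable.copy gen (can_type bool_of_genK).

(* The word x y x ... of length m; this is (x,y)_m. *)
Definition alt (x y : gen) (m : nat) : word gen :=
  mkseq (fun i => (if odd i then y else x, false)) m.

Variant art_rel (m : nat) : word gen -> word gen -> Prop :=
  | ArtRel : art_rel m (alt ga gb m) (alt gb ga m).

Definition Art (m : nat) : groupType := presented (art_rel m).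

Definition art_val (m : nat) (w : word gen) : Art m := wclass (art_rel m) w.

Definition reduced (w : word gen) : Prop :=
  forall (x : gen) (e : bool), ~~ infix [:: (x, e); (x, ~~ e)] w.

(* The moves also act on the inverses of the two words. With the first two
   moves alone the word a b^-1 a^-1 b, trivial in Art 2, and the word
   b a b^-1 a^-1 b^-1 a, trivial in Art 3, could not be rewritten at all. *)
Variant art_move (m : nat) : word gen -> word gen -> Prop :=
  | MoveAB : art_move m (alt ga gb m) (alt gb ga m)
  | MoveBA : art_move m (alt gb ga m) (alt ga gb m)
  | MoveABV : art_move m (winv (alt ga gb m)) (winv (alt gb ga m))
  | MoveBAV : art_move m (winv (alt gb ga m)) (winv (alt ga gb m)).

Definition art_reduces (m : nat) : word gen -> word gen -> Prop :=
  clos_refl_trans (word gen) (wstep (art_move m)).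

(* Main.v *)
(* Adjoin to [Art m] an involution sigma exchanging a and b, and put
   c = a sigma.  Then a = c sigma, b = sigma c and (a,b)_m = c^m sigma^m, so the
   defining relation says that c^m commutes with sigma: [Art m] sits with index
   2 in a central extension of Z/2 * Z/m by <c^m>.  In a reduced word without
   (a,b)_m, (b,a)_m and their inverses, each maximal alternating run of length r
   becomes one syllable c^r or c^-r with 0 < r < m, so a nonempty such word is
   nontrivial even modulo c^m; this is (3).

   A trivial word has exponent sum 0, hence if it contains a half twist it also
   contains a letter of the opposite sign.  The half twist slides towards it
   across the letters of its own sign and cancels there; this gives (4).

   Every element is z^k p with p positive without half twists, and p is
   determined by its syllables.  If z^k p is central and p is not empty, then
   h p = p h' for well-chosen short positive words h, which is absurd; hence (1).

   For (2), the kernel of the exponent sum is generated by a^i b a^(-i-1) for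
   0 <= i < m-1, and conjugation by a induces an automorphism of the free group
   on these symbols.  The resulting action of [Art m] on that free group shows
   that the kernel is free.  Its product with <z^2> is the group of elements
   whose exponent sum is divisible by 2m. *)
Require Import Defs.
From HB Require Import structures.
From mathcomp Require Import all_boot all_order all_algebra.
From mathcomp Require Import zify ring.
From Stdlib Require Import Relations.Relation_Operators.

Set Implicit Arguments.
Unset Strict Implicit.
Unset Printing Implicit Defensive.

Import Order.TTheory GRing.Theory Num.Theory.

(** * Actions of words on a set *)

Section WordAction.
Variables (X T : Type) (la : X * bool -> T -> T).

Definition wact (w : word X) (t : T) : T := foldr la t w.

Lemma wact_cat u v t : wact (u ++ v) t = wact u (wact v t).
Proof. exact: foldr_cat. Qed.

(** Under these hypotheses the words act through the presented group. Actions of this kind are used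
    below to tell elements apart. *)
Lemma wact_weq (R : word X -> word X -> Prop) :
    (forall x e t, la (x, e) (la (x, ~~ e) t) = t) ->
    (forall l r t, R l r -> wact l t = wact r t) ->
  forall u v, weq R u v -> wact u =1 wact v.
Proof.
move=> laK laR u v; elim=> {u v} [u v [p q l r lr|p q x e]|//|u v _ IH|u v w _ IH1 _ IH2] t.
- by rewrite !wact_cat (laR _ _ _ lr).
- by rewrite !wact_cat /= laK.
- by rewrite IH.
- by rewrite IH1.
Qed.

End WordAction.

(** * Alternating words *)

Definition swap (x : gen) : gen := if x is ga then gb else ga.

Lemma swapK : involutive swap. Proof. by case. Qed.

Lemma iter_swapK n : involutive (iter n swap).
Proof. by elim: n => // n IHn x; rewrite iterSr iterS swapK IHn. Qed.

Lemma neq_swap x y : (x != y) = (y == swap x). Proof. by case: x; case: y. Qed.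

(** A recursive form of [alt] that also carries a sign: the two half twists and their inverses are
    the words [altw x e m]. *)
Fixpoint altw (x : gen) (e : bool) (n : nat) : word gen :=
  if n is n'.+1 then (x, e) :: altw (swap x) e n' else [::].

Lemma size_altw x e n : size (altw x e n) = n.
Proof. by elim: n x => //= n IHn x; rewrite IHn. Qed.

Lemma altw_add x e n k : altw x e (n + k) = altw x e n ++ altw (iter n swap x) e k.
Proof. by elim: n x => //= n IHn x; rewrite IHn -iterSr. Qed.

Lemma altwSr x e n : altw x e n.+1 = rcons (altw x e n) (iter n swap x, e).
Proof. by rewrite -addn1 altw_add cats1. Qed.

Lemma winv_altw x e n : winv (altw x e n) = altw (iter n.-1 swap x) (~~ e) n.
Proof.
elim: n => // n IHn; rewrite altwSr /winv map_rcons rev_rcons -/(winv _) IHn /=.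
by case: n {IHn} => //= n; rewrite swapK.
Qed.

Lemma alt_altw x n : alt x (swap x) n = altw x false n.
Proof.
rewrite /alt; elim: n x => // n IHn x; rewrite /= -IHn -[in swap (swap x)]/id.
rewrite /mkseq /= -[iota 1 n]/(iota (1 + 0) n) iotaDl -map_comp; congr (_ :: _).
by apply: eq_map => i /=; rewrite swapK; case: odd.
Qed.

(** * Words without cancellations and half twists *)

Section GoodWords.
Variable m : nat.

Definition cancels (l l' : gen * bool) := (l.1 == l'.1) && (l.2 != l'.2).
Definition alternates (l l' : gen * bool) := (l.1 != l'.1) && (l.2 == l'.2).

Fixpoint run (w : word gen) : nat :=
  if w is l :: w' then
    if w' is l' :: _ then if alternates l l' then (run w').+1 else 1 else 1
  else 0.

(** Bounding the longest alternating prefix, [run], of every suffix bounds all alternating runs. *)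
Fixpoint good (w : word gen) : bool :=
  if w is l :: w' then
    [&& good w', (if w' is l' :: _ then ~~ cancels l l' else true) & run w < m]
  else true.

Lemma run_cons2 l l' w :
  run [:: l, l' & w] = if alternates l l' then (run (l' :: w)).+1 else 1.
Proof. by []. Qed.

Arguments run : simpl never.

Lemma run_cons l w : 0 < run (l :: w) <= (run w).+1.
Proof.
by case: w => [|l' w] //; rewrite run_cons2; case: ifP => //; rewrite ltnS leqnn.
Qed.

Lemma run_prefix x e w : prefix (altw x e (run ((x, e) :: w))) ((x, e) :: w).
Proof.
elim: w x => [|[y d] w IHw] x; first by rewrite /= eqxx.
rewrite run_cons2; case: ifP => [|_]; last by rewrite /= eqxx.
rewrite /alternates /= neq_swap => /andP[/eqP yx /eqP ed]; subst y d.
by have := IHw (swap x); rewrite /= eqxx.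
Qed.

Lemma good_run w : 0 < m -> good w -> run w < m.
Proof. by case: w => //= l w m0 /and3P[]. Qed.

Lemma good_drop n w : good w -> good (drop n w).
Proof. by elim: n w => [|n IHn] [|l w] //= /and3P[/IHn]. Qed.

Lemma not_good_infix w : 0 < m -> ~~ good w ->
  (exists x e, infix [:: (x, e); (x, ~~ e)] w) \/
  (exists x e, infix (altw x e m) w).
Proof.
move=> m0; elim: w => // -[x e] w IHw.
have up v : infix v w -> infix v ((x, e) :: w).
  by move=> vw; apply: infix_trans vw (infix_cons _ _).
have [gw|/IHw[[y [d yd]]|[y [d yd]]]] := boolP (good w); first last.
- by right; exists y, d; apply: up.
- by left; exists y, d; apply: up.
rewrite [good _]/= gw andTb negb_and => /orP[|big].
  case: w {IHw up gw} => // -[y d] w; rewrite negbK => /andP[/= /eqP <- ed].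
  left; exists x, e; have -> : ~~ e = d by case: e d ed => -[].
  exact: (@prefix_infix _ [:: (x, e); (x, d)]).
right; exists x, e; move: big; rewrite -leqNgt => /subnKC mrun.
apply: (@prefixW _ _ ((x, e) :: w)); apply: prefix_trans (run_prefix x e w).
by rewrite -mrun altw_add prefix_prefix.
Qed.

Lemma run_cat u l v : u != [::] -> last l u = l ->
  run (u ++ l :: v) = run u.
Proof.
elim: u => // l1 [|l2 u] IHu _ lastu.
  by rewrite /= run_cons2 -[l1]/(last l [:: l1]) lastu /alternates eqxx.
by rewrite /= !run_cons2 -IHu.
Qed.

(** Two equal adjacent letters neither cancel nor alternate, so every run stops at the seam. With
    [u] nonempty, [last l u = l] says that [u] ends in [l]. *)
Lemma good_cat u l v : u != [::] -> last l u = l ->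
  good (u ++ l :: v) = good u && good (l :: v).
Proof.
elim: u => // l1 [|l2 u] IHu _ lastu.
  have {lastu} <- : l1 = l := lastu.
  by have /= -> := @run_cat [:: l1] l1 v isT erefl; rewrite /cancels !eqxx andbC.
have /= IH := IHu isT lastu.
by rewrite [LHS]/= IH -!cat_cons run_cat //= -!andbA; do !bool_congr.
Qed.

End GoodWords.

Arguments run : simpl never.

(** * The action on sequences of syllables *)

Section SyllableAction.
Variable m : nat.
Hypothesis m1 : 1 < m.

(* The pair (e, [:: r1; ...; rn]) stands for the coset of
   c^e sigma c^r1 ... sigma c^rn modulo <sigma>; it is normal when 0 < ri < m. *)
Definition state : Type := int * seq int.

(** Left multiplication by sigma. If m divides e, then c^e is central and sigma either cancels the
    next sigma or is absorbed by the coset; otherwise the remainder of e becomes a new syllable. A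
    head out of range is left alone, which makes [sigma] an involution on all states. *)
Definition sigma (t : state) : state :=
  let: (e, s) := t in
  if (m %| e)%Z then
    if s is r :: s' then if (0 < r < m)%R then ((e + r)%R, s') else t else t
  else ((e - (e %% m)%Z)%R, (e %% m)%Z :: s).

Definition rotc (k : int) (t : state) : state := ((t.1 + k)%R, t.2).

Definition sgn (e : bool) : int := if e then (-1)%R else 1%R.

(** Singles out a = c sigma and b^-1 = c^-1 sigma from b = sigma c and a^-1 = sigma c^-1. *)
Definition cfirst (l : gen * bool) : bool := (l.1 == ga) (+) l.2.

Definition lact (l : gen * bool) (t : state) : state :=
  if cfirst l then rotc (sgn l.2) (sigma t) else sigma (rotc (sgn l.2) t).

Lemma modm_bounds e : ~~ (m %| e)%Z -> (0 < (e %% m)%Z < m)%R.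
Proof.
have m0 : (m : int) != 0%R by case: m m1.
rewrite lt_neqAle modz_ge0 // andbT eq_sym => /dvdz_mod0P/eqP -> /=.
by have := ltz_mod e m0.
Qed.

Lemma dvdz_small (r : int) : (0 < r < m)%R -> ((m %| r)%Z = false) * ((r %% m)%Z = r).
Proof.
case/andP=> r0 rm; have rK : (r %% m)%Z = r by rewrite modz_small // ltW.
by split=> //; apply/negP => /dvdz_mod0P; rewrite rK => r00; rewrite r00 in r0.
Qed.

Lemma dvdzD_mod (e f : int) : (m %| e)%Z -> ((e + f) %% m)%Z = (f %% m)%Z.
Proof. by move=> /dvdz_mod0P e0; rewrite -modzDml e0 add0r. Qed.

Lemma dvdz_mod_eq (e f : int) : (e %% m)%Z = (f %% m)%Z -> (m %| e)%Z = (m %| f)%Z.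
Proof. by move=> ef; apply/dvdz_mod0P/dvdz_mod0P; rewrite ef. Qed.

Lemma sigmaK : involutive sigma.
Proof.
move=> [e s]; rewrite /sigma; case: ifP => me.
  case: s => [|r s]; first by rewrite me.
  case: ifP => r0; last by rewrite me r0.
  rewrite (dvdz_mod_eq (dvdzD_mod r me)) dvdzD_mod // !(dvdz_small r0).
  by rewrite addrK.
have md : (m %| (e - (e %% m)%Z)%R)%Z.
  by apply/dvdzP; exists (e %/ m)%Z; rewrite {1}(divz_eq e m) addrK.
by rewrite md modm_bounds ?me // subrK.
Qed.

Arguments sigma : simpl never.
Arguments rotc : simpl never.

Lemma rotcD j k t : rotc j (rotc k t) = rotc (k + j) t.
Proof. by rewrite /rotc /= addrA. Qed.

Lemma rotc0 t : rotc 0 t = t.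
Proof. by case: t => e s; rewrite /rotc addr0. Qed.

Lemma sigma_rotc t : sigma (rotc m t) = rotc m (sigma t).
Proof.
case: t => e s; rewrite /rotc /sigma /=.
have em : ((e + m) %% m)%Z = (e %% m)%Z by rewrite modzDr.
rewrite (dvdz_mod_eq em) em; case: ifP => _; last by rewrite addrAC.
by case: s => // r s; case: ifP => _ //; rewrite addrAC.
Qed.

Lemma lactK x e t : lact (x, e) (lact (x, ~~ e) t) = t.
Proof.
by case: x e => -[]; rewrite /lact /= ?sigmaK rotcD ?(addrN, addNr) rotc0 ?sigmaK.
Qed.

(** These are the identities $(a,b)_n = c^n\sigma^n$ and $(b,a)_n = \sigma c^n\sigma^{n+1}$. *)
Lemma wact_altw n t :
  wact lact (altw ga false n) t = rotc n (if odd n then sigma t else t) /\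
  wact lact (altw gb false n) t = sigma (rotc n (if odd n then t else sigma t)).
Proof.
elim: n => [|n [IHa IHb]]; first by rewrite /= rotc0 /= rotc0 sigmaK.
have nS : (n.+1%:Z = n%:Z + 1)%R by rewrite -addn1 PoszD.
have laE u : lact (ga, false) u = rotc 1 (sigma u) by [].
have lbE u : lact (gb, false) u = sigma (rotc 1 u) by [].
split.
  rewrite -[LHS]/(lact (ga, false) (wact lact (altw gb false n) t)) IHb laE.
  by rewrite sigmaK rotcD -nS /=; case: odd.
rewrite -[LHS]/(lact (gb, false) (wact lact (altw ga false n) t)) IHa lbE.
by rewrite rotcD -nS /=; case: odd.
Qed.

Lemma wact_art u v : weq (art_rel m) u v -> wact lact u =1 wact lact v.
Proof.
apply: wact_weq; first exact: lactK.
move=> l r t []; rewrite (alt_altw ga) (alt_altw gb).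
by have [-> ->] := wact_altw m t; case: odd; rewrite sigma_rotc ?sigmaK.
Qed.

Definition origin : state := (0%R, [::]).

(* The first syllable of the state, up to powers of the central element c^m, is
   c^k if b, and sigma followed by c^k otherwise. *)
Definition reads (b : bool) (k : int) (t : state) : Prop :=
  if b then (t.1 %% m)%Z = (k %% m)%Z
  else (m %| t.1)%Z /\ exists s, t.2 = (k %% m)%Z :: s.

Lemma reads_sigma b k t : ~~ (m %| k)%Z -> reads b k t -> reads (~~ b) k (sigma t).
Proof.
move=> mk; case: t => e s; rewrite /sigma; case: b => /=.
  move=> ek; rewrite (dvdz_mod_eq ek) (negPf mk) /= ek; split; last by exists s.
  by apply/dvdzP; exists (e %/ m)%Z; rewrite -ek {1}(divz_eq e m) addrK.
by case=> me [s' ->]; rewrite me modm_bounds //= dvdzD_mod // modz_mod.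
Qed.

Lemma reads_rotc b k j t :
  reads b k t -> reads true (if b then k + j else j)%R (rotc j t).
Proof.
case: b => /= [e|[e _]]; last exact: dvdzD_mod.
by rewrite -modzDml e modzDml.
Qed.

Lemma reads_origin j : reads true j (rotc j origin).
Proof. by rewrite /= add0r. Qed.

Lemma sigma_origin : sigma origin = origin.
Proof. by rewrite /sigma /= dvdz0. Qed.

Lemma reads_proper b k e : ~~ (m %| k)%Z -> reads b k (e, [::]) -> ~~ (m %| e)%Z.
Proof. by move=> mk; case: b => /= [/dvdz_mod_eq ->|[_ []]]. Qed.

Definition signed_run (w : word gen) : int :=
  if w is l :: _ then (sgn l.2 * run w)%R else 0%R.

Lemma signed_run_proper l w : good m (l :: w) -> ~~ (m %| signed_run (l :: w))%Z.
Proof.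
move=> /and3P[_ _ rm]; have /andP[r0 _] := run_cons l w.
rewrite /= dvdzE abszM; have -> : `|sgn l.2|%N = 1%N by case: l.2.
by rewrite mul1n gtnNdvd.
Qed.

(** The initial run contributes the syllable c^k with k its signed length. As 0 < |k| < m, this
    syllable never vanishes modulo c^m, so the next sigma opens a new one. *)
Lemma good_reads l w :
  good m (l :: w) -> reads (cfirst l) (signed_run (l :: w)) (wact lact (l :: w) origin).
Proof.
elim: w l => [|l' w IHw] l gw.
  have := signed_run_proper gw; rewrite /= /lact -[run _]/1%N mulr1 => mk.
  case: (cfirst l); first by rewrite sigma_origin; apply: reads_origin.
  exact: (reads_sigma mk (reads_origin _)).
have mk := signed_run_proper gw; move: (gw) => /and3P[gw' nc _].
have := IHw _ gw'; have mk' := signed_run_proper gw'.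
set t := wact _ _ _ => rt; rewrite [wact _ _ _]/(lact l t) /lact.
(* For letters that do not cancel, equal values of [cfirst] mean that a sigma remains between their
   powers of c, that is, the run breaks. *)
have srE : signed_run (l :: l' :: w) =
  if cfirst l == cfirst l' then sgn l.2 else (signed_run (l' :: w) + sgn l.2)%R.
  rewrite /= run_cons2; case: l l' nc {gw mk IHw gw' mk' t rt} => x e [y d].
  by case: x e y d => -[] [] [] //= _; rewrite ?mulr1 // -addn1 PoszD mulrDr mulr1.
case cl: (cfirst l) srE => srE.
  have := reads_rotc (sgn l.2) (reads_sigma mk' rt).
  by rewrite srE; case: (cfirst l').
have := reads_rotc (sgn l.2) rt.
have -> : (if cfirst l' then (signed_run (l' :: w) + sgn l.2)%R else sgn l.2) =
  signed_run (l :: l' :: w) by rewrite srE; case: cfirst.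
exact: reads_sigma.
Qed.

Lemma good_wact_proper l w e : good m (l :: w) ->
  wact lact (l :: w) origin = (e, [::]) -> ~~ (m %| e)%Z.
Proof.
move=> gw we; apply: (reads_proper (signed_run_proper gw)).
by rewrite -we; apply: good_reads.
Qed.

Definition pos (p : seq gen) : word gen := [seq (x, false) | x <- p].

(** The state reveals the first letter: its exponent is a multiple of m after b but not after a.
    Removing that letter allows induction. *)
Lemma good_pos_inj p q : good m (pos p) -> good m (pos q) ->
  wact lact (pos p) origin = wact lact (pos q) origin -> p = q.
Proof.
elim: p q => [|x p IHp] [|y q] // gp gq.
- by move/esym/(good_wact_proper gq); rewrite dvdz0.
- by move/(good_wact_proper gp); rewrite dvdz0.
move=> pq; have [mp mq] := (signed_run_proper gp, signed_run_proper gq).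
have rp := good_reads gp; have := good_reads gq; rewrite -pq => rq.
have xy : x = y.
  case: x y {pq} gp gq mp mq rp rq => [] [] //= _ _ mp mq.
    by move=> /dvdz_mod_eq ep [ed _]; rewrite -ep ed in mp.
  by move=> [ed _] /dvdz_mod_eq eq; rewrite -eq ed in mq.
rewrite -{}xy in gq pq *; congr (_ :: _).
move: gp gq => /and3P[gp _ _] /and3P[gq _ _]; apply: IHp => //.
by move: (congr1 (lact (x, true)) pq); rewrite /= !(lactK x true).
Qed.

End SyllableAction.

(** * Homomorphisms from presented groups, integer powers, exponent sum *)

Local Open Scope group_scope.

Section Lift.
Variables (X : choiceType) (R : word X -> word X -> Prop) (H : groupType).
Variable f : X -> H.

Definition evl (w : word X) : H :=
  foldr (fun l h => (if l.2 then (f l.1)^-1 else f l.1) * h) 1 w.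

Lemma evl_cat u v : evl (u ++ v) = evl u * evl v.
Proof. by elim: u => [|l u IHu] /=; rewrite ?mul1g // IHu mulgA. Qed.

Lemma evl_weq : (forall l r, R l r -> evl l = evl r) ->
  forall u v, weq R u v -> evl u = evl v.
Proof.
move=> fR u v; elim=> {u v} [u v [p q l r lr|p q x e]|//|u v _ -> //|u v w _ -> _ -> //].
- by rewrite !evl_cat (fR _ _ lr).
- by rewrite !evl_cat /=; case: e; rewrite /= mulg1 ?mulgV ?mulVg mul1g.
Qed.

Definition lift (g : presented R) : H := evl (wrepr g).

Lemma lift_class : (forall l r, R l r -> evl l = evl r) ->
  forall w, lift (wclass R w) = evl w.
Proof. by move=> fR w; apply: evl_weq => //; apply: weq_wrepr. Qed.

Lemma liftM : (forall l r, R l r -> evl l = evl r) ->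
  {morph lift : g h / g * h}.
Proof. by move=> fR g h; rewrite [LHS]lift_class // evl_cat. Qed.

Lemma lift1 : (forall l r, R l r -> evl l = evl r) -> lift 1 = 1.
Proof. by move=> fR; rewrite -wclass_nil lift_class. Qed.

End Lift.

Section FreeLift.
Variables (X : choiceType) (H : groupType) (f : X -> H).

Definition free_lift : free_group X -> H := @lift _ _ _ f.

Lemma free_liftM : {morph free_lift : g h / g * h}.
Proof. exact: liftM. Qed.

Lemma free_lift1 : free_lift 1 = 1.
Proof. exact: lift1. Qed.

HB.instance Definition _ := isMultiplicative.Build _ _ free_lift free_liftM.
HB.instance Definition _ :=
  Multiplicative_isUMagmaMorphism.Build _ _ free_lift free_lift1.

Definition free_gen (x : X) : free_group X := wclass _ [:: (x, false)].

Lemma free_lift_gen x : free_lift (free_gen x) = f x.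
Proof. by rewrite /free_lift lift_class //= mulg1. Qed.

End FreeLift.

Lemma wclassV (X : choiceType) (R : word X -> word X -> Prop) w :
  wclass R (winv w) = (wclass R w)^-1.
Proof.
apply: (@mulIg _ (wclass R w)); rewrite mulVg -wclass_cat -wclass_nil.
exact/wclassP/weq_Vmul.
Qed.

Lemma wclass_cons (X : choiceType) (R : word X -> word X -> Prop) l w :
  wclass R (l :: w) = wclass R [:: l] * wclass R w.
Proof. by rewrite -wclass_cat. Qed.

Lemma wclass1V (X : choiceType) (R : word X -> word X -> Prop) x :
  wclass R [:: (x, true)] = (wclass R [:: (x, false)])^-1.
Proof. by rewrite -wclassV. Qed.

Lemma presented_ind (X : choiceType) (R : word X -> word X -> Prop)
    (P : presented R -> Prop) : P 1 ->
    (forall x g, P g -> P (wclass R [:: (x, false)] * g)) ->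
    (forall x g, P g -> P ((wclass R [:: (x, false)])^-1 * g)) ->
  forall g, P g.
Proof.
move=> P1 Pp Pn g; rewrite -[g]wreprK; elim: (wrepr g) => // -[x e] w IHw.
by rewrite wclass_cons; case: e; [rewrite wclass1V; apply: Pn | apply: Pp].
Qed.

Lemma free_ind (X : choiceType) (P : free_group X -> Prop) : P 1 ->
    (forall x g, P g -> P (free_gen x * g)) ->
    (forall x g, P g -> P ((free_gen x)^-1 * g)) ->
  forall g, P g.
Proof. exact: presented_ind. Qed.

Lemma free_lift_unique (X : choiceType) (H : groupType)
    (f g : UMagmaMorphism.type (free_group X) H) :
  (forall x, f (free_gen x) = g (free_gen x)) -> f =1 g.
Proof.
move=> fg; apply: free_ind => [|x h fgh|x h fgh]; first by rewrite !gmulf1.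
- by rewrite !gmulfM fgh fg.
- by rewrite !gmulfM !gmulfV fgh fg.
Qed.

Section IntegerPowers.
Variable G : groupType.
Implicit Types (x y : G) (i j : int).

Lemma expgz1D x i : expgz x (i + 1)%R = expgz x i * x.
Proof.
case: i => [n|[|n]].
- by rewrite -PoszD addn1 /= expgSr.
- by rewrite /= mulVg.
- have -> : (Negz n.+1 + 1)%R = Negz n by lia.
  by rewrite /= [x ^+ n.+2]expgS invgM mulgVK.
Qed.

Lemma expgzD x i j : expgz x (i + j)%R = expgz x i * expgz x j.
Proof.
elim: j => [|n IHn|n IHn]; first by rewrite addr0 mulg1.
- by rewrite -addn1 PoszD addrA !expgz1D IHn mulgA.
- apply: (@mulIg _ x); rewrite -mulgA -!expgz1D -addrA.
  by rewrite -addn1 PoszD opprD subrK -IHn.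
Qed.

Lemma expgzN x i : expgz x (- i)%R = (expgz x i)^-1.
Proof. by apply: (@mulIg _ (expgz x i)); rewrite -expgzD addNr mulVg. Qed.

Lemma expgz_expg x n i : expgz (x ^+ n) i = expgz x (n%:Z * i)%R.
Proof.
elim: i => [|i IHi|i IHi]; first by rewrite mulr0.
- by rewrite -addn1 PoszD expgz1D IHi mulrDr mulr1 expgzD.
- rewrite -addn1 PoszD opprD mulrDr expgzD IHi mulrN1.
  by rewrite [RHS]expgzD [in RHS]expgzN [in LHS]expgzN.
Qed.

Lemma morph_expgz (H : groupType) (f : UMagmaMorphism.type G H) x i :
  f (expgz x i) = expgz (f x) i.
Proof. by case: i => n /=; rewrite ?gmulfXVn ?gmulfXn. Qed.

End IntegerPowers.

Lemma expgz_Zgroup (k : Zgroup) i : expgz k i = (i * (k : int))%R.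
Proof.
elim: i => [|i IHi|i IHi]; first by rewrite mul0r.
- by rewrite -addn1 PoszD expgz1D IHi mulrDl mul1r.
- by rewrite -addn1 PoszD opprD expgzD IHi mulrDl mulN1r.
Qed.

Section ArtinGroup.
Variable m : nat.
Local Notation G := (Art m).
Local Notation cls := (wclass (art_rel m)).

Definition agen (x : gen) : G := cls [:: (x, false)].

Definition expsum : G -> Zgroup := @lift _ _ Zgroup (fun=> 1%R : int).

Lemma evl_altw (H : groupType) (f : gen -> H) x y n :
  (forall x y, f x = f y) -> evl f (altw x false n) = evl f (altw y false n).
Proof. by move=> fE; elim: n x y => //= n IHn x y; rewrite (fE x y) (IHn _ (swap y)). Qed.

Lemma expsum_rel l r : art_rel m l r ->
  evl (fun=> 1%R : Zgroup) l = evl (fun=> 1%R : Zgroup) r.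
Proof. by case; rewrite (alt_altw ga) (alt_altw gb); apply: evl_altw. Qed.

Lemma expsumM : {morph expsum : g h / g * h}.
Proof. exact: liftM expsum_rel. Qed.

Lemma expsum1 : expsum 1 = 1.
Proof. exact: lift1 expsum_rel. Qed.

HB.instance Definition _ := isMultiplicative.Build _ _ expsum expsumM.
HB.instance Definition _ :=
  Multiplicative_isUMagmaMorphism.Build _ _ expsum expsum1.

Lemma expsumV : {morph expsum : g / g^-1}.
Proof. exact: gmulfV. Qed.

Lemma expsum_class w : expsum (cls w) = evl (fun=> 1%R : Zgroup) w.
Proof. exact: lift_class expsum_rel w. Qed.

Lemma expsum_expgz g i : expsum (expgz g i) = (i * (expsum g : int))%R.
Proof. by rewrite [LHS]morph_expgz; apply: expgz_Zgroup. Qed.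

Lemma expsum_agen x : expsum (agen x) = 1%R.
Proof. by rewrite expsum_class. Qed.

(** The Garside element, called the half twist here. *)
Definition delta : G := cls (altw ga false m).

Lemma delta_altw x : cls (altw x false m) = delta.
Proof.
case: x => //; rewrite /delta -(alt_altw ga) -(alt_altw gb); apply/esym/wclassP.
by apply: rst_step; rewrite -[alt _ _ _]cats0 -[alt gb _ _]cats0; apply: (WReplace [::]).
Qed.

Lemma expsum_delta : expsum delta = m%:Z%R.
Proof.
rewrite expsum_class; elim: m ga => // n IHn x /=; rewrite IHn.
by rewrite [LHS]addrC -PoszD addn1.
Qed.

End ArtinGroup.

(** * The word problem *)

Section WordProblem.
Variable m : nat.
Hypothesis m1 : 1 < m.
Local Notation G := (Art m).
Local Notation cls := (wclass (art_rel m)).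

Lemma wact_cls u v t : cls u = cls v -> wact (lact m) u t = wact (lact m) v t.
Proof. by move=> /wclassP uv; apply: wact_art. Qed.

Lemma trivial_not_good w : w <> [::] -> cls w = 1 -> ~~ good m w.
Proof.
case: w => // l w _ w1; apply/negP => gw.
have := good_wact_proper m1 gw (wact_cls (origin) (etrans w1 (esym (wclass_nil _)))).
by rewrite dvdz0.
Qed.

Lemma trivial_infix w : reduced w -> w <> [::] -> cls w = 1 ->
  exists x e, infix (altw x e m) w.
Proof.
move=> rw w0 w1.
have [[x [e xe]]|//] := not_good_infix (ltnW m1) (trivial_not_good w0 w1).
by have := rw x e; rewrite xe.
Qed.

Lemma art_reduces_ctx s t u v :
  art_reduces m u v -> art_reduces m (s ++ u ++ t) (s ++ v ++ t).
Proof.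
elim=> {u v} [u v [p q l r lr|p q x e]|u|u v w _ uv _ vw].
- by apply: rt_step; rewrite -!catA ![s ++ p ++ _]catA; apply: WReplace.
- by apply: rt_step; rewrite -!catA ![s ++ p ++ _]catA; apply: WCancel.
- exact: rt_refl.
- exact: rt_trans uv vw.
Qed.

Lemma art_reduces_cls u v : art_reduces m u v -> cls u = cls v.
Proof.
have ab : cls (alt ga gb m) = cls (alt gb ga m).
  by rewrite (alt_altw ga) (alt_altw gb) !delta_altw.
elim=> {u v} [u v [p q l r lr|p q x e]|//|u v w _ -> _ -> //].
  by rewrite !wclass_cat; case: lr; rewrite ?wclassV ab.
rewrite !wclass_cat wclass_cons; congr (_ * _); rewrite -[RHS]mul1g; congr (_ * _).
by case: e; rewrite wclass1V ?mulVg ?mulgV.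
Qed.

Lemma art_reduces_altw x y e : art_reduces m (altw x e m) (altw y e m).
Proof.
have [->|] := eqVneq x y; first exact: rt_refl.
rewrite neq_swap => /eqP -> {y}; apply: rt_step.
have step l r : art_move m l r -> wstep (art_move m) l r.
  by move=> lr; have := WReplace [::] [::] lr; rewrite !cats0.
apply: step; case: e.
  have wi y : altw y true m = winv (altw (iter m.-1 swap y) false m).
    by rewrite winv_altw iter_swapK.
  rewrite !wi -iterSr iterS; case: (iter _ _ x) => /=.
    by rewrite -(alt_altw ga) -(alt_altw gb); apply: MoveABV.
  by rewrite -(alt_altw ga) -(alt_altw gb); apply: MoveBAV.
by case: x; rewrite -(alt_altw ga) -(alt_altw gb); [apply: MoveAB | apply: MoveBA].
Qed.

Lemma altw_rcons x e : altw x e m = rcons (altw x e m.-1) (iter m.-1 swap x, e).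
Proof. by rewrite -altwSr (ltn_predK m1). Qed.

Lemma altw_cons x e : altw x e m = (x, e) :: altw (swap x) e m.-1.
Proof. by rewrite -[RHS]/(altw x e m.-1.+1) (ltn_predK m1). Qed.

(* A half twist moves across letters of its own sign, changing them into each
   other, and cancels against the first letter of the opposite sign. *)
Lemma twist_right x e s : has (fun l => l.2 != e) s ->
  exists2 w, art_reduces m (altw x e m ++ s) w & size w < m + size s.
Proof.
elim: s x => // -[y d] s IHs x /=; have [-> /= hs|de _] := eqVneq d e.
  (* A half twist that begins with x' is prolonged by y, so the two together read as x' followed by
     a half twist. *)
  pose x' := iter m swap y.
  have [w tw sw] := IHs (swap x') hs; exists ((x', e) :: w); last by rewrite /= addnS.
  apply: rt_trans (art_reduces_ctx [::] _ (art_reduces_altw x x' e)) _ => /=.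
  have -> : altw x' e m ++ (y, e) :: s = (x', e) :: altw (swap x') e m ++ s.
    by rewrite -cat_rcons -{1}(iter_swapK m y) -altwSr.
  by have := art_reduces_ctx [:: (x', e)] [::] tw; rewrite !cats0.
(* A half twist that begins with x' ends in y, ready to cancel. *)
pose x' := iter m.-1 swap y; exists (altw x' e m.-1 ++ s).
  apply: rt_trans (art_reduces_ctx [::] _ (art_reduces_altw x x' e)) _.
  rewrite /= altw_rcons iter_swapK cat_rcons; apply: rt_step.
  by have -> : d = ~~ e; [move: de; case: (d) (e) => -[] | apply: WCancel].
by rewrite size_cat size_altw; have := m1; lia.
Qed.

Lemma twist_left x e s : has (fun l => l.2 != e) s ->
  exists2 w, art_reduces m (s ++ altw x e m) w & size w < m + size s.
Proof.
elim/last_ind: s x => // s [y d] IHs x; rewrite has_rcons /=.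
have [-> /= hs|de _] := eqVneq d e.
  have [w tw sw] := IHs y hs; exists (rcons w (iter m swap y, e)).
    have st := art_reduces_ctx (rcons s (y, e)) [::] (art_reduces_altw x (swap y) e).
    rewrite !cats0 in st; apply: rt_trans st _.
    rewrite cat_rcons -[_ :: _]/(altw y e m.+1) altwSr -cats1 catA -cats1.
    exact: (art_reduces_ctx [::] [:: _] tw).
  by rewrite !size_rcons addnS.
exists (s ++ altw (swap y) e m.-1).
  have st := art_reduces_ctx (rcons s (y, d)) [::] (art_reduces_altw x y e).
  rewrite !cats0 in st; apply: rt_trans st _.
  rewrite cat_rcons altw_cons; apply: rt_step.
  have -> : e = ~~ d by move: de; case: (d) (e) => -[].
  exact: WCancel.
by rewrite size_cat size_rcons size_altw; have := m1; lia.
Qed.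

Lemma evl_same_sign e (w : word gen) : all (fun l => l.2 == e) w ->
  evl (fun=> 1%R : Zgroup) w = (sgn e * (size w)%:Z)%R.
Proof.
elim: w => [|[x d] w IHw] /=; first by rewrite mulr0.
move=> /andP[/eqP -> /IHw ->]; rewrite -addn1 PoszD mulrDr mulr1.
by rewrite [LHS]addrC; case: (e).
Qed.

Lemma trivial_reduces w : cls w = 1 -> art_reduces m w [::].
Proof.
have [n] := ubnP (size w); elim: n w => // n IHn w /ltnSE sw w1.
have [->|w0] := eqVneq w [::]; first exact: rt_refl.
have shrink u : art_reduces m w u -> size u < size w -> art_reduces m w [::].
  move=> wu su; have u1 : cls u = 1 by rewrite -(art_reduces_cls wu).
  exact: rt_trans wu (IHn u (leq_trans su sw) u1).
have [[x [e]]|[x [e]]] := not_good_infix (ltnW m1) (trivial_not_good (elimN eqP w0) w1).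
  case/infixP => p [s wE]; apply: (shrink (p ++ s)); rewrite wE.
    by apply: rt_step; apply: WCancel.
  by rewrite !size_cat /= !addnS ltnS leqW.
case/infixP => p [s wE].
(* Otherwise all letters of the nonempty word have sign e, and its exponent sum is not 0. *)
have : has (fun l => l.2 != e) w.
  rewrite has_predC; apply: contraNN w0 => /evl_same_sign.
  rewrite -(expsum_class m) w1 expsum1 -size_eq0 => w0.
  have {}w0 : (0 = sgn e * (size w)%:Z)%R := w0.
  rewrite -eqz_nat; move: w0; rewrite /sgn.
  by case: (e); rewrite ?mulN1r ?mul1r => /eqP; rewrite eq_sym ?oppr_eq0.
rewrite {1}wE !has_cat => /or3P[hp|hm|hs].
- have [u pu su] := twist_left x hp; apply: (shrink (u ++ s)).
    by rewrite wE catA; apply: (art_reduces_ctx [::]).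
  by rewrite wE !size_cat size_altw addnA ltn_add2r addnC.
- suff : all (fun l => l.2 == e) (altw x e m) by rewrite has_predC in hm; move/negP: hm.
  by elim: (m) x {wE hm} => //= k IHk x; rewrite eqxx IHk.
- have [u su zu] := twist_right x hs; apply: (shrink (p ++ u)).
    by rewrite wE -[u]cats0 -[s]cats0; have := art_reduces_ctx p [::] su; rewrite !cats0.
  by rewrite wE !size_cat size_altw ltn_add2l.
Qed.

End WordProblem.

(** * The center *)

Section Center.
Variable m : nat.
Hypothesis m1 : 1 < m.
Local Notation G := (Art m).
Local Notation cls := (wclass (art_rel m)).
Local Notation z := (delta m).

Lemma art_ind (P : G -> Prop) : P 1 ->
    (forall x g, P g -> P (agen m x * g)) ->
    (forall x g, P g -> P ((agen m x)^-1 * g)) ->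
  forall g, P g.
Proof. exact: presented_ind. Qed.

Definition twist (b : bool) (x : gen) : gen := if b then swap x else x.

Lemma iter_swap n x : iter n swap x = twist (odd n) x.
Proof. by elim: n => //= n ->; case: odd; rewrite /= ?swapK. Qed.

(** Both sides spell the alternating word of length m + 1 that begins with x. *)
Lemma agen_delta x : agen m x * z = z * agen m (twist (odd m) x).
Proof.
transitivity (cls (altw x false m.+1)).
  by rewrite -(delta_altw _ (swap x)) [RHS]wclass_cons.
by rewrite altwSr -cats1 wclass_cat delta_altw iter_swap.
Qed.

Lemma agen_expgz_delta x k :
  agen m x * expgz z k = expgz z k * agen m (twist (odd m && odd `|k|) x).
Proof.
elim: k x => [|n IHn|n IHn] x; first by rewrite andbF mulg1 mul1g.
  rewrite -{1 2}addn1 PoszD expgz1D mulgA IHn -!mulgA agen_delta; congr (_ * (_ * agen _ _)).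
  by rewrite /=; case: (odd m); case: (odd n); rewrite /= ?swapK.
have nE : (- n.+1%:Z + 1 = - n%:Z)%R by rewrite -addn1 PoszD opprD subrK.
apply: (@mulIg _ z); rewrite -!mulgA agen_delta -expgz1D mulgA -expgz1D nE IHn.
congr (_ * agen _ _); rewrite !abszN /=.
by case: (odd m); case: (odd n); rewrite /= ?swapK.
Qed.

Lemma expgz_delta_central k : ~~ (odd m && odd `|k|) -> center (expgz z k).
Proof.
move=> mk h; elim/art_ind: h => [|x h ch|x h ch].
- exact: commute1.
- by apply: commuteM => //; rewrite /commute agen_expgz_delta (negPf mk).
- apply: commuteM => //; apply: commuteV.
  by rewrite /commute agen_expgz_delta (negPf mk).
Qed.

(** The Garside normal form. *)
Definition garside (g : G) : Prop :=
  exists k p, g = expgz z k * cls (pos p) /\ good m (pos p).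

Lemma garside_delta k g : garside g -> garside (expgz z k * g).
Proof.
by move=> [j [p [-> gp]]]; exists (k + j)%R, p; rewrite expgzD mulgA.
Qed.

Lemma garside_agen x g : garside g -> garside (agen m x * g).
Proof.
move=> [k [p [-> gp]]]; set y := twist (odd m && odd `|k|) x.
have -> : agen m x * (expgz z k * cls (pos p)) = expgz z k * cls (pos (y :: p)).
  by rewrite mulgA agen_expgz_delta -mulgA -wclass_cat.
apply: garside_delta.
have [gyp|ngood] := boolP (good m (pos (y :: p))).
  by exists 0%R, (y :: p); rewrite mul1g.
(* Prepending y lengthens the initial run by at most one, so the new half twist is exactly that run;
   taken out as z, it leaves a suffix of p. *)
have ry : run (pos (y :: p)) = m.
  apply/eqP; rewrite eqn_leq; have /andP[_ /leq_trans->] := run_cons (y, false) (pos p).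
    rewrite leqNgt; apply: contra ngood => ry /=; rewrite gp ry andbT.
    by case: (p) => //= x' p'; rewrite /cancels andbF.
  exact: good_run (ltnW m1) gp.
have /prefixP[s ps] := run_prefix y false (pos p).
exists 1%R, (drop m (y :: p)); rewrite /pos map_drop -/(pos _); split.
  rewrite -(delta_altw _ y) /= -wclass_cat; congr wclass.
  by rewrite ps ry drop_size_cat ?size_altw.
have -> : drop m (pos (y :: p)) = drop m.-1 (pos p) by rewrite -{1}(ltn_predK m1).
exact: good_drop.
Qed.

Lemma garside_altw x n g : garside g -> garside (cls (altw x false n) * g).
Proof.
move=> gg; elim: n x => [|n IHn] x; first by rewrite wclass_nil mul1g.
by rewrite /= wclass_cons -mulgA; apply: garside_agen.
Qed.

Lemma garsideP g : garside g.
Proof.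
apply: art_ind g => [|x g|x g gg]; last 1 first.
(* Deleting the first letter of a half twist expresses the inverse of x by positive letters and
   z^-1. *)
- have -> : (agen m x)^-1 = cls (altw (swap x) false m.-1) * expgz z (-1).
    apply: (@mulgI _ (agen m x)); rewrite mulgV mulgA -wclass_cons.
    by rewrite -altw_cons // delta_altw mulgV.
  by rewrite -mulgA; apply/garside_altw/garside_delta.
- by exists 0%R, [::]; rewrite mulg1.
- exact: garside_agen.
Qed.

Lemma good_pos_cls_inj p q : good m (pos p) -> good m (pos q) ->
  cls (pos p) = cls (pos q) -> p = q.
Proof.
by move=> gp gq /wact_cls pq; apply: (good_pos_inj m1) => //; apply: pq.
Qed.

Lemma agen_neq : agen m ga <> agen m gb.
Proof.
have good1 x : good m (pos [:: x]) by rewrite /= -[run _]/1%N m1.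
by move=> /(@good_pos_cls_inj [:: ga] [:: gb] (good1 _) (good1 _)).
Qed.

Lemma rcons_cons_nseq (T : Type) (x y : T) s :
  x :: s = rcons s y -> y = x /\ s = nseq (size s) x.
Proof.
elim: s => [[->]|a s IHs] //= [<- /IHs[-> {1}->]] //.
Qed.

Lemma good_pos_cat p q : p != [::] -> q != [::] -> last ga p = head ga q ->
  good m (pos p) -> good m (pos q) -> good m (pos (p ++ q)).
Proof.
case: q => // y q p0 _ pq gp gq; rewrite /pos map_cat /= good_cat.
- by apply/andP.
- by case: p p0 {pq gp}.
- by case: p p0 pq {gp} => //= x p _ <-; rewrite last_map.
Qed.

Hypothesis m2 : 2 < m.

(** Let f be the effect on letters of conjugation by z^k. If h begins with the last letter of p and
    f(h) ends with the first letter of p, then f(h) p and p h are good. Commutation with h makes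
    them equal in the group, hence equal as words. Three choices of h are contradictory. *)
Lemma central_pos k p : good m (pos p) ->
  center (expgz z k * cls (pos p)) -> p = [::].
Proof.
move=> gp cg; apply/eqP; apply: contraT => p0.
pose f := twist (odd m && odd `|k|).
have fK : involutive f by rewrite /f; case: (_ && _) => //=; apply: swapK.
have fS x : f (swap x) = swap (f x) by rewrite /f; case: (_ && _).
have mv h : cls (pos h) * expgz z k = expgz z k * cls (pos (map f h)).
  elim: h => [|x h IHh]; first by rewrite mul1g mulg1.
  rewrite /= wclass_cons -mulgA IHh mulgA -/(agen m x) agen_expgz_delta.
  by rewrite -mulgA -wclass_cons.
have test h : h != [::] -> head ga h = last ga p -> f (last ga h) = head ga p ->
    good m (pos h) -> good m (pos (map f h)) -> map f h ++ p = p ++ h.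
  move=> h0 hh hl gh gfh; apply: good_pos_cls_inj.
  - apply: good_pos_cat => //; first by case: (h) h0.
    by case: (h) h0 hl => //= x s _ <-; rewrite last_map.
  - exact: good_pos_cat.
  have posD u v : pos (u ++ v) = pos u ++ pos v by apply: map_cat.
  apply: (@mulgI _ (expgz z k)); rewrite !posD !wclass_cat [RHS]mulgA [RHS]cg.
  by rewrite mulgA -mv mulgA.
have good2 x y : good m (pos [:: x; y]).
  by rewrite /= /cancels andbF run_cons2 -[run _]/1%N; case: ifP; rewrite ?m1 ?m2.
case: p gp cg p0 mv test => // x p gp cg _ _ test; set q := last ga (x :: p) in test.
(* Compare the first letters for h = q f(x). *)
have fq : f q = x.
  by have /= [-> //] := test [:: q; f x] isT erefl (fK x) (good2 _ _) (good2 _ _).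
(* For h = q the equation shifts the whole word by one place, so all its letters agree. *)
have [qx pE] : q = x /\ p = nseq (size p) x.
  have := test [:: q] isT erefl fq; rewrite /= fq -[run _]/1%N m1 cats1 => /(_ isT isT) e.
  by have [qx [pE]] := rcons_cons_nseq e.
have good4 y : good m (pos [:: y; swap y; swap y; y]).
  have := @good_pos_cat [:: y; swap y] [:: swap y; y] isT isT erefl.
  by apply; apply: good2.
(* The second letters of the two sides now differ. *)
have := test [:: q; swap q; swap q; q] isT erefl fq (good4 _).
rewrite /= fS fq => /(_ (good4 _)); rewrite qx pE.
by case: (size p) x {pE test fq qx q gp cg} => [|n] [].
Qed.

Lemma center_art :
  infinite_cyclic_generated_by (@center G) (if odd m then z ^+ 2 else z).
Proof.
set c := if odd m then _ else _.
have cE i : expgz c i = expgz z ((odd m).+1%:Z * i)%R.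
  by rewrite /c; case: odd; [rewrite expgz_expg | rewrite mul1r].
split=> [g|i j].
  split=> [cg|[i ->]].
    have [k [p [gE gp]]] := garsideP g.
    rewrite gE in cg; have p0 := central_pos gp cg.
    (* For m and k both odd, z^k would exchange a and b. *)
    have kE : (odd m && odd `|k|) = false.
      apply/negP => mk; have := cg (agen m ga).
      rewrite p0 wclass_nil mulg1 /commute agen_expgz_delta mk => /mulgI/agen_neq.
      exact.
    exists (if odd m then (k %/ 2)%Z else k); rewrite cE gE p0 wclass_nil mulg1.
    by move: kE; case: (odd m) => /= kE; congr expgz; lia.
  by rewrite cE; apply: expgz_delta_central; case: (odd m); lia.
(* The exponent sum of c^i is i times a nonzero constant. *)
move=> /(congr1 (@expsum m)); rewrite !cE !expsum_expgz expsum_delta.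
have m0 := ltnW m1 => /eqP; rewrite -subr_eq0 -mulrBl -mulrBr !mulf_eq0 subr_eq0.
by case/orP=> [/orP[|/eqP]|] //; case: (m) m0.
Qed.

End Center.

(** * The kernel of the exponent sum *)

Section AlternatingProduct.
Variable S : groupType.
Implicit Types (b : bool) (s t : nat -> S).

(** The ordered product of the [s i] with i < n, over even i if b holds and over odd i otherwise. *)
Fixpoint altprod b s n : S :=
  if n is n'.+1 then (if b then s 0 else 1) * altprod (~~ b) (s \o succn) n'
  else 1.

Lemma eq_altprod b s t n :
  (forall i, i < n -> s i = t i) -> altprod b s n = altprod b t n.
Proof.
elim: n b s t => //= n IHn b s t st; rewrite st // (IHn _ _ (t \o succn)) //.
by move=> i ni; apply: st.
Qed.

Lemma altprodSr b s n :
  altprod b s n.+1 = altprod b s n * (if odd n != b then s n else 1).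
Proof.
elim: n b s => [|n IHn] b s; first by case: b; rewrite /= ?mulg1 ?mul1g.
rewrite [LHS]/= -/(altprod _ _ n.+1) IHn mulgA; congr (_ * _).
by rewrite /=; case: (odd n); case: b.
Qed.

(* In [Art n.+1], with s i = a^i b a^(-i-1), the two sides are
   (b,a)_(n+1) a^(-n-1) and (a,b)_(n+1) a^(-n-1). *)
Definition balanced n s := altprod true s n.+1 = altprod false s n.+1.
Definition solve_first n s := altprod true s n * (altprod false s n)^-1.
Definition solve_last n s :=
  (altprod (~~ odd n) s n)^-1 * altprod (odd n) s n.

(** [s 0] occurs in only one of the two products, as its first factor, so the equation can be solved
    for it. *)
Lemma balanced_first n s : balanced n s <-> s 0 = solve_first n (s \o succn).
Proof.
rewrite /balanced /solve_first /= mul1g; split=> [<-|->]; first by rewrite mulgK.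
by rewrite mulgVK.
Qed.

(** [s n] is the last factor of just one product; the parity of n decides which. *)
Lemma balanced_last n s : balanced n s <-> s n = solve_last n s.
Proof.
rewrite /balanced /solve_last !altprodSr; case: odd; rewrite /= mulg1.
  by split=> [->|->]; rewrite ?mulKg ?mulVKg.
by split=> [<-|->]; rewrite ?mulKg ?mulVKg.
Qed.

End AlternatingProduct.

Lemma morph_altprod (S T : groupType) (f : UMagmaMorphism.type S T) b s n :
  f (altprod b s n) = altprod b (f \o s) n.
Proof.
by elim: n b s => [|n IHn] b s; rewrite /= ?gmulf1 // gmulfM IHn; case: b; rewrite ?gmulf1.
Qed.

(** * The action of the Artin group on a free group *)

Section Monodromy.
Variable k : nat.
Local Notation n := k.+1.
Local Notation m := k.+2.
Local Notation F := (free_group 'I_n).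
Local Notation G := (Art m).
Local Notation cls := (wclass (art_rel m)).

Definition basis (i : nat) : F := free_gen (inord i).

(* The free generators are extended by the values that the defining relation
   forces upon a^n b a^(-n-1) and a^-1 b; note that [basis_down i] has index
   i - 1. *)
Definition basis_up (i : nat) : F := if i < n then basis i else solve_last n basis.
Definition basis_down (i : nat) : F :=
  if i is j.+1 then basis j else solve_first n basis.

(** [up] and [down] model conjugation of the kernel by a and by a^-1. *)
Definition up : F -> F := free_lift (fun i : 'I_n => basis_up i.+1).
Definition down : F -> F := free_lift (fun i : 'I_n => basis_down i).

HB.instance Definition _ := UMagmaMorphism.on up.
HB.instance Definition _ := UMagmaMorphism.on down.

Lemma upM : {morph up : f g / f * g}. Proof. exact: gmulfM. Qed.
Lemma upV : {morph up : f / f^-1}. Proof. exact: gmulfV. Qed.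

Lemma free_gen_basis (i : 'I_n) : free_gen i = basis i.
Proof. by rewrite /basis inord_val. Qed.

Lemma up_basis i : i < n -> up (basis i) = basis_up i.+1.
Proof. by move=> ni; rewrite [LHS]free_lift_gen inordK. Qed.

Lemma down_basis i : i < n -> down (basis i) = basis_down i.
Proof. by move=> ni; rewrite [LHS]free_lift_gen inordK. Qed.

Lemma basis_upE i : i < n -> basis_up i = basis i.
Proof. by rewrite /basis_up => ->. Qed.

Lemma balanced_up : balanced n basis_up.
Proof.
apply/balanced_last; rewrite {1}/basis_up ltnn /solve_last.
by congr (_^-1 * _); apply: eq_altprod => i ni; rewrite basis_upE.
Qed.

Lemma balanced_down : balanced n basis_down.
Proof. exact/balanced_first. Qed.

Lemma upK : cancel up down.
Proof.
apply: (@free_lift_unique _ _ (down \o up) idfun) => x.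
rewrite /= free_gen_basis up_basis //; have xn : x.+1 <= n by [].
move: xn; rewrite leq_eqVlt => /orP[/eqP xn|xn]; last first.
  by rewrite basis_upE // down_basis.
(* Only the last generator involves the relation: [down] turns [solve_last] of [basis] into
   [solve_last] of [basis_down], which by balance is [basis_down n], that is, [basis k]. *)
rewrite xn {1}/basis_up ltnn /solve_last gmulfM gmulfV !morph_altprod.
have E b : altprod b (down \o basis) n = altprod b basis_down n.
  by apply: eq_altprod => i ni; rewrite /= down_basis.
rewrite !E; have /balanced_last := balanced_down; rewrite /solve_last => <-.
by have -> : x = k :> nat by case: xn.
Qed.

Lemma downK : cancel down up.
Proof.
apply: (@free_lift_unique _ _ (up \o down) idfun) => x.
rewrite /= free_gen_basis down_basis //; case: x => -[|i] ni /=.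
  rewrite /solve_first gmulfM gmulfV !morph_altprod.
  have E b : altprod b (up \o basis) n = altprod b (basis_up \o succn) n.
    by apply: eq_altprod => i ni'; rewrite /= up_basis.
  rewrite !E; have /balanced_first := balanced_up; rewrite /solve_first => <-.
  by rewrite basis_upE.
by rewrite up_basis ?basis_upE // ltnW.
Qed.

(* The left action on the cosets of <a>, each of which meets the kernel of the
   exponent sum in one point. *)
Definition free_act (l : gen * bool) (f : F) : F :=
  match l with
  | (ga, false) => up f
  | (ga, true) => down f
  | (gb, false) => basis 0 * up f
  | (gb, true) => down ((basis 0)^-1 * f)
  end.

Lemma free_actK x e f : free_act (x, e) (free_act (x, ~~ e) f) = f.
Proof. by case: x e => -[] /=; rewrite ?upK ?downK ?mulVKg ?mulKg ?upK ?downK. Qed.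

Lemma iter_up i : i <= n -> iter i up (basis 0) = basis_up i.
Proof.
elim: i => [|i IHi] ni; first by rewrite basis_upE.
by rewrite iterS IHi ?(ltnW ni) // basis_upE // up_basis.
Qed.

(** Moving every [up] to the right past the factors [basis 0] applies it i times to the factor at
    position i. *)
Lemma free_act_altw x j f : wact free_act (altw x false j) f =
  altprod (x == gb) (fun i => iter i up (basis 0)) j * iter j up f.
Proof.
elim: j x f => [|j IHj] x f; first by rewrite /= mul1g.
have gM b : up (altprod b (fun i => iter i up (basis 0)) j) =
    altprod b ((fun i => iter i up (basis 0)) \o succn) j by apply: morph_altprod.
rewrite [LHS]/(free_act (x, false) (wact free_act (altw (swap x) false j) f)).
by rewrite IHj; case: x; rewrite /= upM gM ?mul1g ?mulgA.
Qed.

(** Both half twists act as [iter m up] followed by a left translation; the two translations agree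
    because [basis_up] is balanced. *)
Lemma wact_free u v : weq (art_rel m) u v -> wact free_act u =1 wact free_act v.
Proof.
apply: wact_weq; first exact: free_actK.
move=> l r f []; rewrite (alt_altw ga) (alt_altw gb) !free_act_altw; congr (_ * _).
have E b : altprod b (fun i => iter i up (basis 0)) m = altprod b basis_up m.
  by apply: eq_altprod => i im; rewrite iter_up.
by rewrite !E; apply/esym/balanced_up.
Qed.

Local Notation A := (agen m ga).
Local Notation B := (agen m gb).

Definition kergen (i : nat) : G := A ^+ i * B * A ^- i.+1.

Lemma kergenS i : kergen i.+1 = A * kergen i * A^-1.
Proof. by rewrite /kergen (expgS A i.+1) invgM {1}expgS !mulgA. Qed.

(** The product telescopes: between consecutive factors a^(-l-1) meets a^(l+2), leaving one a
    between two letters b. *)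
Lemma altprod_kergen b i j :
  altprod b (fun l => kergen (i + l)) j =
  A ^+ i * cls (altw (if b then gb else ga) false j) * A ^- (i + j).
Proof.
elim: j b i => [|j IHj] b i; first by rewrite /= wclass_nil mulg1 addn0 mulgV.
rewrite [LHS]/= (@eq_altprod _ _ _ (fun l => kergen (i.+1 + l))) => [|l _]; last first.
  by rewrite /= addSnnS.
rewrite IHj addSnnS addn0 [RHS]/= -addSnnS; case: b => /=.
  rewrite [cls (_ :: _)]wclass_cons -/B /kergen !mulgA mulgVK.
  by rewrite -[A ^+ i * B * _]mulgA.
by rewrite mul1g [cls (_ :: _)]wclass_cons -/A expgSr !mulgA.
Qed.

Lemma balanced_kergen : balanced n kergen.
Proof.
have E b := altprod_kergen b 0 m.
by rewrite /balanced (E true) (E false) !delta_altw.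
Qed.

Definition theta : F -> G := free_lift (fun i : 'I_n => kergen i).
HB.instance Definition _ := UMagmaMorphism.on theta.

Lemma thetaM : {morph theta : f g / f * g}. Proof. exact: gmulfM. Qed.
Lemma thetaV : {morph theta : f / f^-1}. Proof. exact: gmulfV. Qed.
Lemma theta1 : theta 1 = 1. Proof. exact: gmulf1. Qed.

Lemma theta_basis i : i < n -> theta (basis i) = kergen i.
Proof. by move=> ni; rewrite [LHS]free_lift_gen inordK. Qed.

Lemma theta_basis_up i : i <= n -> theta (basis_up i) = kergen i.
Proof.
rewrite leq_eqVlt => /orP[/eqP->|ni]; last by rewrite basis_upE // theta_basis.
rewrite /basis_up ltnn /solve_last gmulfM gmulfV !morph_altprod.
have E b : altprod b (theta \o basis) n = altprod b kergen n.
  by apply: eq_altprod => j nj; rewrite /= theta_basis.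
by rewrite !E; have /balanced_last := balanced_kergen.
Qed.

Lemma theta_up f : theta (up f) = A * theta f * A^-1.
Proof.
have upx (x : 'I_n) : theta (up (free_gen x)) = A * theta (free_gen x) * A^-1.
  by rewrite free_gen_basis up_basis // theta_basis_up // theta_basis // kergenS.
elim/free_ind: f => [|x f IHf|x f IHf]; first by rewrite [up 1]gmulf1 !theta1 mulg1 mulgV.
- by rewrite upM !thetaM upx IHf !mulgA mulgVK.
- by rewrite upM !thetaM upV !thetaV upx IHf !invgM invgK !mulgA mulgVK.
Qed.

Lemma theta_down f : theta (down f) = A^-1 * theta f * A.
Proof. by rewrite -{2}(downK f) theta_up !mulgA mulVg mul1g mulgVK. Qed.

Lemma expsum_kergen i : expsum (kergen i) = 1.
Proof.
rewrite /kergen -[A ^+ i]/(expgz A i) -[A ^+ i.+1]/(expgz A i.+1) -expgzN !expsumM.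
rewrite !expsum_expgz !expsum_agen !mulr1.
by rewrite -[LHS]/(i%:Z + 1 - i.+1%:Z)%R -addn1 PoszD addrN.
Qed.

Lemma expsum_theta f : expsum (theta f) = 0%R.
Proof.
have ex (x : 'I_n) : expsum (theta (free_gen x)) = 1.
  by rewrite free_gen_basis theta_basis // expsum_kergen.
elim/free_ind: f => [|x f IHf|x f IHf]; first by rewrite theta1 expsum1.
- by rewrite thetaM expsumM IHf ex mul1g.
- by rewrite thetaM thetaV expsumM IHf expsumV ex invg1 mul1g.
Qed.

(** Left multiplication by a letter changes the factor f exactly as [free_act] prescribes. *)
Lemma theta_factor g : exists f, g = theta f * expgz A (expsum g).
Proof.
suff [f [i gE]] : exists f i, g = theta f * expgz A i.
  exists f; rewrite {1}gE; congr (_ * expgz _ _).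
  by rewrite gE expsumM expsum_theta expsum_expgz expsum_agen mulr1 [RHS]add0r.
elim/art_ind: g => [|[] g [f [i ->]]|[] g [f [i ->]]].
- by exists 1, 0%R; rewrite theta1 mulg1.
- exists (up f), (1 + i)%R; rewrite theta_up expgzD /= mulgA.
  by rewrite mulgA mulgVK.
- exists (basis 0 * up f), (1 + i)%R; rewrite thetaM theta_basis // theta_up expgzD /=.
  by rewrite /kergen mul1g !mulgA !mulgVK.
- exists (down f), (- 1 + i)%R; rewrite theta_down expgzD /=.
  by rewrite !mulgA mulgK.
- exists (down ((basis 0)^-1 * f)), (- 1 + i)%R.
  rewrite theta_down thetaM thetaV theta_basis // expgzD /=.
  by rewrite /kergen mul1g invgM invgK !mulgA mulVg mul1g mulgK.
Qed.

Definition gact (g : G) (f : F) : F := wact free_act (wrepr g) f.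

Lemma gact_cls w f : gact (cls w) f = wact free_act w f.
Proof. exact/wact_free/weq_wrepr. Qed.

Lemma gactM g h f : gact (g * h) f = gact g (gact h f).
Proof. by rewrite [LHS]gact_cls wact_cat. Qed.

Lemma gact_kergen i f : i < n -> gact (kergen i) f = basis i * f.
Proof.
have gAV h : gact A^-1 h = down h by rewrite -wclass1V gact_cls.
elim: i f => [|i IHi] f ni.
  by rewrite /kergen mul1g gactM gAV gact_cls /= downK.
rewrite kergenS 2!gactM gAV IHi ?(ltnW ni) // gact_cls /=.
by rewrite upM downK up_basis ?(ltnW ni) // basis_upE.
Qed.

(** Through [theta] the free group acts on itself by left translation, and this action is faithful;
    so [theta] is injective. *)
Lemma gact_theta h f : gact (theta h) f = h * f.
Proof.
elim/free_ind: h => [|x h IHh|x h IHh].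
- by rewrite theta1 -wclass_nil gact_cls mul1g.
- by rewrite thetaM gactM IHh free_gen_basis theta_basis // gact_kergen // mulgA.
- rewrite thetaM gactM IHh thetaV free_gen_basis theta_basis //.
  apply: (@mulgI _ (basis x)); rewrite -gact_kergen // -gactM mulgV.
  by rewrite -wclass_nil gact_cls /= !mulgA mulgV mul1g.
Qed.

Lemma theta_inj : injective theta.
Proof. by move=> f g fg; rewrite -[f]mulg1 -[g]mulg1 -!gact_theta fg. Qed.

Local Notation z := (delta m).

(** Even powers of z are central for every parity of m, which makes this map a morphism. *)
Definition theta_z (u : (F * Zgroup)%type) : G :=
  theta u.1 * expgz z (2 * (u.2 : int))%R.

Lemma delta_even_central i : center (expgz z (2 * i)%R).
Proof. by apply: expgz_delta_central; rewrite abszM oddM andbF. Qed.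

Lemma theta_zM : {morph theta_z : u v / u * v}.
Proof.
move=> [f i] [g j]; rewrite /theta_z /= thetaM mulrDr expgzD !mulgA.
by congr (_ * _); rewrite -!mulgA; congr (_ * _); apply/esym/delta_even_central.
Qed.

HB.instance Definition _ := isMultiplicative.Build _ _ theta_z theta_zM.

Lemma expsum_theta_z u : expsum (theta_z u) = ((u.2 : int) * (2 * m)%N%:Z)%R.
Proof.
rewrite expsumM expsum_theta expsum_expgz expsum_delta [LHS]add0r.
by rewrite PoszM mulrA [(2 * _)%R]mulrC.
Qed.

Lemma theta_z_inj : injective theta_z.
Proof.
move=> u v uv; have := congr1 (@expsum m) uv; rewrite !expsum_theta_z.
move=> /(mulIf (isT : (2 * m)%N%:Z%R != 0%R)) uv2.
move: uv; rewrite /theta_z uv2 => /mulIg/theta_inj.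
by case: u v uv2 => [f i] [g j] /= -> ->.
Qed.

Lemma virtually_free_times_Z_art : virtually_free_times_Z G.
Proof.
pose S : {pred G} := [pred g | ((2 * m)%N %| (expsum g : int))%Z].
exists S; split.
- split=> [|g h]; first by rewrite inE expsum1 dvdz0.
  by rewrite !inE expsumM expsumV => eg eh; apply: rpredB.
(* The coset of g is determined by its exponent sum modulo 2m, and a^i has exponent sum i. *)
- exists [seq A ^+ i | i <- iota 0 (2 * m)] => g.
  pose i := `|((expsum g : int) %% (2 * m)%N)%Z|%N.
  have iE : i%:Z%R = ((expsum g : int) %% (2 * m)%N)%Z by rewrite /i gez0_abs // modz_ge0.
  exists (A ^+ i); first by rewrite map_f // mem_iota /= -ltz_nat iE ltz_pmod.
  rewrite inE expsumM expsumV -[A ^+ i]/(expgz A i) expsum_expgz expsum_agen mulr1 iE.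
  apply/dvdzP; exists ((expsum g : int) %/ (2 * m)%N)%Z.
  by rewrite [LHS]addrC {1}(divz_eq (expsum g : int) (2 * m)%N) addrK.
exists 'I_n, theta_z; split=> [|g]; first exact: theta_z_inj.
rewrite inE; split=> [/dvdzP[q gq]|[u <-]]; last by rewrite expsum_theta_z dvdz_mull.
(* Multiplying by z^(-2q) brings the exponent sum to 0, so no power of a remains. *)
have [f fE] := theta_factor (g * expgz z (2 * - q)%R).
exists (f, q); rewrite /theta_z /=; apply: (@mulIg _ (expgz z (2 * - q)%R)).
rewrite fE -mulgA -expgzD -mulrDr addrN mulr0 mulg1 expsumM expsum_expgz expsum_delta gq.
set e := (e in expgz A e); have -> : e = 0%R; last by rewrite mulg1.
rewrite -[e]/(q * (2 * m)%N%:Z + 2 * - q * m%:Z)%R PoszM; ring.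
Qed.

End Monodromy.

(* The guard 2 < m concerns the center only: Art 2 is the free abelian group
   Z^2, which is its own center and is not cyclic. *)
Theorem theorem6p2 (m : nat) (hm : (1 < m)%N) :
  let z : Art m := art_val m (alt ga gb m) in
  z = art_val m (alt gb ga m) /\
  [/\ (2 < m)%N ->
        infinite_cyclic_generated_by (@center (Art m))
          (if odd m then z ^+ 2 else z),
      virtually_free_times_Z (Art m),
      forall w : word gen, reduced w -> w <> [::] -> art_val m w = 1 ->
        exists2 u : word gen,
          u \in [:: alt ga gb m; alt gb ga m;
                    winv (alt ga gb m); winv (alt gb ga m)]
          & infix u w
    & forall w : word gen, art_val m w = 1 -> art_reduces m w [::]].
Proof.
move=> z; have zE x : art_val m (altw x false m) = delta m by apply: delta_altw.
have zD : z = delta m by rewrite /z (alt_altw ga) zE.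
split; first by rewrite zD (alt_altw gb) zE.
split.
- by move=> m2; rewrite zD; apply: center_art.
- by case: m hm {z zE zD} => [|[|k]] // _; apply: virtually_free_times_Z_art.
- move=> w rw w0 w1; have [x [e xw]] := trivial_infix hm rw w0 w1.
  exists (altw x e m) => //; rewrite (alt_altw ga) (alt_altw gb) !winv_altw !inE.
  (* [winv_altw] gives inverse half twists with first letter [iter m.-1 swap y]; x is put in the
     same form. *)
  have [y ->] : exists y, x = iter m.-1 swap y.
    by exists (iter m.-1 swap x); rewrite iter_swapK.
  case: e {xw}; first by case: y; rewrite eqxx ?orbT.
  by case: (iter _ _ y); rewrite eqxx ?orbT.
- exact: trivial_reduces.
Qed.
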